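(* For $0\le\nu\le N$ and $m\ge1$ define $$b^{[m]}_{A,\nu}:=\inf\{x\ge1:g_A(x)\ge c^{[m]}_\nu(x)\},\qquad D^{[m]}_{A,\nu}:=\{x>0:g_A(x)\ge c^{[m]}_\nu(x)\}.$$ Then $b^{[m]}_{A,\nu}<\infty$ and $D^{[m]}_{A,\nu}\cap[1,\infty)=[b^{[m]}_{A,\nu},\infty)$. Furthermore $b^{[m+1]}_{A,\nu}\le b^{[m]}_{A,\nu}$, and the recursive first-entry rule into these upper regions is optimal: with $\min\emptyset:=\partial$, $$\sigma^*_m=\min\{\nu\in\{0,\dots,N\}:R_\nu\ge b^{[m]}_{A,\nu}\},\quad\sigma^*_i=\min\{\nu\in\{0,\dots,N\}:\nu>\sigma^*_{i+1},\ R_\nu\ge b^{[i]}_{A,\nu}\},\ i=m-1,\dots,1,$$ attains the supremum in $\sup_{\vec\sigma\in\mathcal T^{[m]}_0}\mathrm E\big[\sum_{i:\,\sigma_i\le N}\alpha^{\sigma_i}(G_{\sigma_i}-S_{\sigma_i})^+\big]$. At the terminal date $b^{[m]}_{A,N}=1$.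
   Context: Let $r\ge0$, $\alpha:=(1+r)^{-1}$, and $\lambda>1$ with $\lambda^{-1}<1+r<\lambda$. Put $p:=\frac{(1+r)-\lambda^{-1}}{\lambda-\lambda^{-1}}$, $q:=1-p$ (both in $(0,1)$). Let $N$ be a finite horizon, $S_0=s_0>0$ a constant and $S_\nu=s_0\lambda^{\varepsilon_1+\dots+\varepsilon_\nu}$ ($0\le\nu\le N$), where under $\mathrm P$ the $\varepsilon_\nu$ are i.i.d. with $\mathrm P(\varepsilon_\nu=1)=p$, $\mathrm P(\varepsilon_\nu=-1)=q$; $(\mathcal F_\nu)_{\nu=0}^N$ is the natural filtration of $S$. Let $G_\nu:=(\prod_{j=0}^\nu S_j)^{1/(\nu+1)}$, $R_\nu:=G_\nu/S_\nu$, $g_A(x):=(x-1)^+$ for $x>0$, and $a_\nu:=\frac{\nu+1}{\nu+2}$. Put $\widetilde p:=\alpha\lambda p$, $\widetilde q:=\alpha\lambda^{-1}q$ (so $\widetilde p+\widetilde q=1$), and for functions $\varphi$ on $(0,\infty)$ and $0\le\nu<N$ let $(\mathcal C_\nu\varphi)(x):=\widetilde p\,\varphi(\lambda^{-a_\nu}x^{a_\nu})+\widetilde q\,\varphi(\lambda^{a_\nu}x^{a_\nu})$. Define on $(0,\infty)$: $J^{[0]}_\nu\equiv0$, $J^{[m]}_N=g_A$ ($m\ge1$), and for $0\le\nu<N$, $m\ge1$, $$J^{[m]}_\nu(x)=\max\{g_A(x)+(\mathcal C_\nu J^{[m-1]}_{\nu+1})(x),\ (\mathcal C_\nu J^{[m]}_{\nu+1})(x)\}.$$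 Put $\Delta J^{[m]}_\nu:=J^{[m]}_\nu-J^{[m-1]}_\nu$, $c^{[m]}_\nu:=\mathcal C_\nu\Delta J^{[m]}_{\nu+1}$ ($\nu<N$), $c^{[m]}_N:=0$. Admissible exercise vectors: let $\partial:=+\infty$ denote non-exercise. $\mathcal T^{[m]}_0$ is the set of vectors $(\sigma_m,\dots,\sigma_1)$ of $(\mathcal F_\nu)$-stopping times with values in $\{0,\dots,N\}\cup\{\partial\}$ such that, pathwise, for some $\ell\in\{0,\dots,m\}$ (possibly depending on $\omega$) the finite coordinates are exactly $\sigma_m,\dots,\sigma_{m-\ell+1}$, with $0\le\sigma_m<\sigma_{m-1}<\dots<\sigma_{m-\ell+1}\le N$, and the remaining coordinates equal $\partial$. *)

(* Defs.v *)
From HB Require Import structures.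
From mathcomp Require Import all_boot all_order all_algebra finmap.
From mathcomp Require Import all_classical all_reals all_analysis.

Set Implicit Arguments.
Unset Strict Implicit.
Unset Printing Implicit Defensive.

Import Order.TTheory GRing.Theory Num.Theory.
Import numFieldNormedType.Exports.

Local Open Scope classical_set_scope.
Local Open Scope ring_scope.

Section Recursion.
Context {R : realType}.

Definition discount (r : R) : R := (1 + r)^-1.

Definition up_prob (r lambda : R) : R :=
  ((1 + r) - lambda^-1) / (lambda - lambda^-1).

Definition down_prob (r lambda : R) : R := 1 - up_prob r lambda.

Definition tilted_up (r lambda : R) : R :=
  discount r * lambda * up_prob r lambda.

Definition tilted_down (r lambda : R) : R :=
  discount r * lambda^-1 * down_prob r lambda.

Definition pos_part (x : R) : R := Num.max x 0.

Definition gA (x : R) : R := pos_part (x - 1).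

Definition avg_exp (nu : nat) : R := nu.+1%:R / nu.+2%:R.

(* Functions on (0, oo) are represented by total functions on R, of which only
   the values at positive arguments are meaningful; for x > 0 and lambda > 0
   both arguments of phi below are positive. *)
Definition cont_op (r lambda : R) (nu : nat) (phi : R -> R) (x : R) : R :=
  tilted_up r lambda * phi (lambda `^ (- avg_exp nu) * x `^ avg_exp nu) +
  tilted_down r lambda * phi (lambda `^ avg_exp nu * x `^ avg_exp nu).

(* J_to_go k m is the value function at the date N - k. *)
Fixpoint J_to_go (r lambda : R) (N k m : nat) : R -> R :=
  match m, k with
  | 0, _ => fun=> 0
  | _.+1, 0 => gA
  | m'.+1, k'.+1 => fun x =>
      Num.max
        (gA x + cont_op r lambda (N - k)%N (J_to_go r lambda N k' m') x)
        (cont_op r lambda (N - k)%N (J_to_go r lambda N k' m) x)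
  end.

Definition J (r lambda : R) (N m nu : nat) : R -> R :=
  J_to_go r lambda N (N - nu)%N m.

Lemma J0 (r lambda : R) (N nu : nat) : J r lambda N 0 nu = fun=> 0.
Proof. by rewrite /J; case: (N - nu)%N. Qed.

Lemma J_terminal (r lambda : R) (N m : nat) :
  (0 < m)%N -> J r lambda N m N = gA.
Proof. by case: m => // m _; rewrite /J subnn. Qed.

Lemma J_rec (r lambda : R) (N m nu : nat) (x : R) :
  (0 < m)%N -> (nu < N)%N ->
  J r lambda N m nu x =
  Num.max (gA x + cont_op r lambda nu (J r lambda N m.-1 nu.+1) x)
          (cont_op r lambda nu (J r lambda N m nu.+1) x).
Proof.
case: m => // m _ nuN; rewrite /J -(subnSK nuN) /= subnSK //.
by rewrite (subKn (ltnW nuN)).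
Qed.

Definition DeltaJ (r lambda : R) (N m nu : nat) (x : R) : R :=
  J r lambda N m nu x - J r lambda N m.-1 nu x.

Definition cA (r lambda : R) (N m nu : nat) (x : R) : R :=
  if (nu < N)%N then cont_op r lambda nu (DeltaJ r lambda N m nu.+1) x else 0.

(* Extended-real infimum: the value is +oo exactly when the set is empty. *)
Definition bA (r lambda : R) (N m nu : nat) : \bar R :=
  ereal_inf
    [set x%:E | x in [set x : R | 1 <= x /\ gA x >= cA r lambda N m nu x]].

Definition DA (r lambda : R) (N m nu : nat) : set R :=
  [set x | 0 < x /\ gA x >= cA r lambda N m nu x].

End Recursion.

(* An element of {0, ..., N} together with None for "never". *)
Definition date (N : nat) : Type := option 'I_N.+1.

Definition date_lt (N : nat) (s t : date N) : bool :=
  match s, t with Some k, Some l => (k < l)%N | _, _ => false end.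

(* The minimum of Q, with min of the empty set equal to None:
   enum 'I_N.+1 lists the dates in increasing order. *)
Definition first_date (N : nat) (Q : pred 'I_N.+1) : date N :=
  ohead [seq nu <- enum 'I_N.+1 | Q nu].

Section Model.
Context {d : measure_display} {T : measurableType d} {R : realType}.

Definition mutually_independent (P : probability T R) (I : set nat)
    (X : nat -> {RV P >-> R}) : Prop :=
  forall (K : {fset nat}) (B : nat -> set R),
    [set` K] `<=` I -> (forall k, k \in K -> measurable (B k)) ->
    P (\bigcap_(k in [set` K]) X k @^-1` B k) =
    (\prod_(k <- K) P (X k @^-1` B k))%E.

Definition iid_signs (P : probability T R) (N : nat) (p q : R)
    (eps : nat -> {RV P >-> R}) : Prop :=
  mutually_independent [set k | (1 <= k <= N)%N] eps /\
  forall k, (1 <= k <= N)%N ->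
    P [set w | eps k w = 1] = p%:E /\ P [set w | eps k w = -1] = q%:E.

Definition price (s0 lambda : R) (eps : nat -> T -> R) (nu : nat) (w : T) : R :=
  s0 * lambda `^ (\sum_(1 <= k < nu.+1) eps k w).

Definition geo_mean (S : nat -> T -> R) (nu : nat) (w : T) : R :=
  (\prod_(0 <= j < nu.+1) S j w) `^ (nu.+1%:R^-1).

Definition ratio (S : nat -> T -> R) (nu : nat) (w : T) : R :=
  geo_mean S nu w / S nu w.

Definition natural_filtration (S : nat -> T -> R) (nu : nat) : set (set T) :=
  <<s \bigcup_(j in [set j | (j <= nu)%N])
        preimage_set_system setT (S j) measurable >>.

Definition stopping_time (N : nat) (F : nat -> set (set T))
    (tau : T -> date N) : Prop :=
  forall nu, (nu <= N)%N ->
    F nu [set w | if tau w is Some k then (k <= nu)%N else false].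

(* The vector (sigma_m, ..., sigma_1) is represented by sigma : nat -> _, of
   which only the values at 1, ..., m matter.  The finite coordinates are those
   with index i > m - l. *)
Definition admissible (N : nat) (F : nat -> set (set T)) (m : nat)
    (sigma : nat -> T -> date N) : Prop :=
  (forall i, (1 <= i <= m)%N -> stopping_time F (sigma i)) /\
  forall w, exists l, [/\ (l <= m)%N,
    forall i, (1 <= i <= m)%N -> isSome (sigma i w) = (m - l < i)%N &
    forall i, (m - l < i < m)%N -> date_lt (sigma i.+1 w) (sigma i w)].

Definition reward (r : R) (S : nat -> T -> R) (N m : nat)
    (sigma : nat -> T -> date N) (w : T) : R :=
  \sum_(1 <= i < m.+1)
    if sigma i w is Some nu
    then discount r ^+ nu * pos_part (geo_mean S nu w - S nu w) else 0.

(* entry_rule b Rt m k is sigma^*_(m - k). *)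
Fixpoint entry_rule (N : nat) (b : nat -> nat -> \bar R) (Rt : nat -> T -> R)
    (m k : nat) (w : T) : date N :=
  match k with
  | 0 => first_date (fun nu : 'I_N.+1 => (b m nu <= (Rt nu w)%:E)%E)
  | k'.+1 => first_date (fun nu : 'I_N.+1 =>
      date_lt (entry_rule N b Rt m k' w) (Some nu) &&
      (b (m - k)%N nu <= (Rt nu w)%:E)%E)
  end.

Definition sigma_star (r lambda : R) (S : nat -> T -> R) (N m i : nat) :
    T -> date N :=
  entry_rule N (bA r lambda N) (ratio S) m (m - i)%N.

End Model.

(* Main.v *)
(** If f >= 0 is nondecreasing and (1 + f x) / x is nonincreasing on (0, oo), then
    {x >= 1 : f x <= x - 1} is a closed upper half-line.  These functions contain
    g_A and are stable under max, min and C_nu (as a_nu < 1 and the tilted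
    probabilities sum to 1).  Since DeltaJ^[1] = max(g_A, c^[1]) and
    DeltaJ^[m] = max(c^[m], min(g_A, c^[m-1])) for m >= 2, backward induction
    keeps every DeltaJ^[m] in this class and makes it nonincreasing in m.

    For optimality, let k_nu be the number of rights left before date nu.  The
    process (past rewards) + alpha^nu S_nu J^[k_nu]_nu(R_nu) is a supermartingale
    for every admissible vector, and a martingale for the entry rule.  As the
    signs are almost surely +1 or -1 and F_nu-measurable sets are unions of
    fibres of (S_0, ..., S_nu), expectations are backward recursions on the
    binary tree of sign paths. *)
Require Import Defs.
From HB Require Import structures.
From mathcomp Require Import all_boot all_order all_algebra finmap.
From mathcomp Require Import all_classical all_reals all_analysis.
From mathcomp Require Import measurable_realfun.
From mathcomp Require Import zify lra ring.
Import Order.TTheory GRing.Theory Num.Theory.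
Import numFieldNormedType.Exports.
Local Open Scope classical_set_scope.
Local Open Scope ring_scope.

(** * Functions of at most proportional growth and their closure properties *)

Section SubproportionalGrowth.
Context {R : realType}.
Set Implicit Arguments.
Unset Strict Implicit.
Implicit Types (f g : R -> R) (x y : R).

(** The third clause is the decrease of [(1 + f x) / x] with denominators cleared. The shift by 1
    makes [gA] a borderline case: [1 + gA x = max(1, x)], so the quotient is constant on
    [x >= 1]. *)
Definition slow f := forall x y, 0 < x -> x <= y ->
  [/\ 0 <= f x, f x <= f y & (1 + f y) * x <= (1 + f x) * y].

Lemma slow_ge0 f x : slow f -> 0 < x -> 0 <= f x.
Proof. by move=> sf x0; have [] := sf x x x0 (lexx x). Qed.

Lemma slow_const0 : slow (fun=> 0).
Proof. by move=> x y x0 xy; split=> //; rewrite !addr0 !mul1r. Qed.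

Lemma eq_slow f g : slow g -> (forall x, 0 < x -> f x = g x) -> slow f.
Proof.
move=> sg fg x y x0 xy; rewrite !fg//; first exact: sg.
exact: lt_le_trans xy.
Qed.

Lemma slow_gA : slow gA.
Proof.
move=> x y x0 xy; rewrite /gA /pos_part.
by split; case: (leP (x - 1) 0); case: (leP (y - 1) 0); nra.
Qed.

Lemma slow_max f g : slow f -> slow g -> slow (fun x => Num.max (f x) (g x)).
Proof.
move=> sf sg x y x0 xy.
have y0 : 0 < y := lt_le_trans x0 xy.
have [f0 fm fd] := sf x y x0 xy; have [g0 gm gd] := sg x y x0 xy.
split.
- by rewrite le_max f0.
- by rewrite ge_max !le_max fm gm orbT.
- case: (leP (f y) (g y)) => _.
    by apply: (le_trans gd); rewrite ler_wpM2r ?(ltW y0)// lerD2l le_max lexx orbT.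
  by apply: (le_trans fd); rewrite ler_wpM2r ?(ltW y0)// lerD2l le_max lexx.
Qed.

Lemma slow_min f g : slow f -> slow g -> slow (fun x => Num.min (f x) (g x)).
Proof.
move=> sf sg x y x0 xy.
have y0 : 0 < y := lt_le_trans x0 xy.
have [f0 fm fd] := sf x y x0 xy; have [g0 gm gd] := sg x y x0 xy.
split.
- by rewrite le_min f0.
- by rewrite le_min !ge_min fm gm orbT.
- case: (leP (f x) (g x)) => _.
    by apply: le_trans fd; rewrite ler_wpM2r ?(ltW x0)// lerD2l ge_min lexx.
  by apply: le_trans gd; rewrite ler_wpM2r ?(ltW x0)// lerD2l ge_min lexx orbT.
Qed.

Lemma avg_exp_ge0 nu : 0 <= avg_exp nu :> R.
Proof. by rewrite divr_ge0. Qed.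

Lemma avg_expE nu : avg_exp nu = 1 - nu.+2%:R^-1 :> R.
Proof.
rewrite /avg_exp; apply: (mulIf (_ : nu.+2%:R != 0)) => //.
by rewrite mulrBl mulfVK// mulVf// mul1r -[nu.+2]addn1 natrD addrK.
Qed.

(** With [u = c * x^a], the quotient [(1 + f u) / x] is [(1 + f u) / u] times [c * x^(a - 1)]. The
    first factor is nonincreasing since [u] increases with [x], the second since [a <= 1]. *)
Lemma slow_comp_powR f a c : 0 < c -> 0 <= a <= 1 -> slow f ->
  slow (fun x => f (c * x `^ a)).
Proof.
move=> c0 /andP[a0 a1] sf x y x0 xy.
have y0 : 0 < y := lt_le_trans x0 xy.
have xa := powR_gt0 a x0; have ya := powR_gt0 a y0.
have xya : x `^ a <= y `^ a by apply: ge0_ler_powR; rewrite // nnegrE ltW.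
have [f0 fm fd] := sf (c * x `^ a) (c * y `^ a) (mulr_gt0 c0 xa)
  (ler_wpM2l (ltW c0) xya).
split=> //.
have xb := powR_gt0 (1 - a) x0; have yb := powR_gt0 (1 - a) y0.
have xyb : x `^ (1 - a) <= y `^ (1 - a).
  by apply: ge0_ler_powR; rewrite ?subr_ge0// nnegrE ltW.
have split_pow z : 0 < z -> z = z `^ a * z `^ (1 - a).
  move=> z0; rewrite -powRD ?(gt_eqF z0) ?implybT//.
  by rewrite addrC subrK powRr1// ltW.
rewrite [X in _ * X <= _](split_pow x x0) [X in _ <= _ * X](split_pow y y0).
rewrite !mulrA ler_pM//; [|exact: ltW|].
  by rewrite mulr_ge0 ?ltW// (lt_le_trans ltr01)// lerDl (le_trans f0).
by rewrite -(ler_pM2l c0) !(mulrCA c).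
Qed.

(** As [p + q = 1], the constant 1 splits into [p + q], and the quotient condition is the weighted
    sum of those for [f] and [g]. *)
Lemma slow_convex_comb f g p q : 0 <= p -> 0 <= q -> p + q = 1 ->
  slow f -> slow g -> slow (fun x => p * f x + q * g x).
Proof.
move=> p0 q0 pq sf sg x y x0 xy.
have [f0 fm fd] := sf x y x0 xy; have [g0 gm gd] := sg x y x0 xy.
split; [by rewrite addr_ge0 ?mulr_ge0|by rewrite lerD ?ler_wpM2l|].
rewrite -[X in X + _]pq -[X in (X + (p * f x + _))]pq.
have := ler_wpM2l p0 fd; have := ler_wpM2l q0 gd; nra.
Qed.

(* Since (1 + f x) / x is nonincreasing, {x >= 1 : f x <= x - 1} is an upper set;
   monotonicity of f makes it closed. *)
Lemma slow_upper f x y : slow f -> 1 <= x -> x <= y -> f x <= x - 1 ->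
  f y <= y - 1.
Proof.
move=> sf x1 xy fx; have x0 : 0 < x by apply: lt_le_trans x1.
have [_ _ fd] := sf x y x0 xy; rewrite -(ler_pM2r x0); nra.
Qed.

Lemma slow_closed f x : slow f -> 0 < x ->
  (forall y, x < y -> f y <= y - 1) -> f x <= x - 1.
Proof.
move=> sf x0 fy; apply/ler_addgt0Pr => e e0.
have xe : x < x + e by rewrite ltrDl.
have [_ fm _] := sf x (x + e) x0 (ltW xe).
by apply: (le_trans fm); rewrite addrAC; exact: fy.
Qed.

(** Comparison with the point 1: monotonicity gives the bound to its left, the decreasing quotient
    the linear bound to its right. *)
Lemma slow_le_max1 f x : slow f -> 0 < x -> 1 + f x <= (1 + f 1) * Num.max 1 x.
Proof.
move=> sf x0; case: (leP 1 x) => [x1|/ltW x1].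
  by have [_ _] := sf 1 x ltr01 x1; rewrite mulr1.
by have [_ f1 _] := sf x 1 x0 x1; rewrite mulr1 lerD2l.
Qed.

End SubproportionalGrowth.

(** * Increments of the value in the number of rights, and the exercise thresholds *)

Section Thresholds.
Context {R : realType}.
Variables (r lambda : R) (N : nat).
Hypotheses (lambda_gt1 : 1 < lambda) (lambda_r : lambda^-1 < 1 + r < lambda).
Set Implicit Arguments.
Unset Strict Implicit.
Implicit Types (f g : R -> R) (x y : R) (m nu : nat).

Let lambda_gt0 : 0 < lambda. Proof. exact: lt_trans lambda_gt1. Qed.

Let spread_gt0 : 0 < lambda - lambda^-1.
Proof. by case/andP: lambda_r => h1 h2; rewrite subr_gt0 (lt_trans h1). Qed.

Let gross_gt0 : 0 < 1 + r.
Proof. by case/andP: lambda_r => h1 _; apply: lt_trans h1; rewrite invr_gt0. Qed.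

Lemma up_prob_gt0 : 0 < up_prob r lambda.
Proof. by case/andP: lambda_r => h1 _; rewrite divr_gt0// subr_gt0. Qed.

Lemma down_prob_gt0 : 0 < down_prob r lambda.
Proof.
case/andP: lambda_r => _ h2.
by rewrite /down_prob subr_gt0 ltr_pdivrMr// mul1r ltrD2r.
Qed.

Lemma discount_gt0 : 0 < discount r.
Proof. by rewrite invr_gt0. Qed.

Lemma tilted_up_gt0 : 0 < tilted_up r lambda.
Proof. exact: mulr_gt0 (mulr_gt0 discount_gt0 lambda_gt0) up_prob_gt0. Qed.

Lemma tilted_down_gt0 : 0 < tilted_down r lambda.
Proof.
by apply: mulr_gt0 down_prob_gt0; apply: mulr_gt0 discount_gt0 _; rewrite invr_gt0.
Qed.

(** The choice of [p] is risk-neutral: the mean price factor [lambda * p + lambda^-1 * q] is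
    [1 + r], which the discount cancels. *)
Lemma tilted_sum : tilted_up r lambda + tilted_down r lambda = 1.
Proof.
rewrite /tilted_up /tilted_down /down_prob /discount -!mulrA -mulrDr.
apply: (mulfI (lt0r_neq0 gross_gt0)); rewrite mulVKf ?lt0r_neq0// mulr1.
rewrite mulrBr mulr1 addrCA -mulrBl /up_prob mulrC mulfVK ?lt0r_neq0//.
by rewrite addrC subrK.
Qed.

Lemma slow_cont_op nu f : slow f -> slow (cont_op r lambda nu f).
Proof.
have a01 : 0 <= (avg_exp nu : R) <= 1.
  by rewrite avg_exp_ge0 avg_expE gerBl invr_ge0 ler0n.
move=> sf; apply: slow_convex_comb; rewrite ?tilted_sum//.
- exact/ltW/tilted_up_gt0.
- exact/ltW/tilted_down_gt0.
- by apply: slow_comp_powR; rewrite ?powR_gt0.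
- by apply: slow_comp_powR; rewrite ?powR_gt0.
Qed.

Lemma le_cont_op nu f g x : (forall y, 0 < y -> f y <= g y) -> 0 < x ->
  cont_op r lambda nu f x <= cont_op r lambda nu g x.
Proof.
move=> fg x0; apply: lerD; (rewrite ler_pM2l; last first);
  rewrite ?tilted_up_gt0 ?tilted_down_gt0//;
  by apply: fg; rewrite mulr_gt0 ?powR_gt0.
Qed.

Lemma cont_opB nu f g x :
  cont_op r lambda nu (fun y => f y - g y) x =
  cont_op r lambda nu f x - cont_op r lambda nu g x.
Proof. by rewrite /cont_op !mulrBr opprD addrACA. Qed.

Lemma cA_lt m nu x : (nu < N)%N ->
  cA r lambda N m nu x = cont_op r lambda nu (DeltaJ r lambda N m nu.+1) x.
Proof. by move=> h; rewrite /cA h. Qed.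

Lemma cA_J m nu x : (nu < N)%N -> cA r lambda N m nu x =
  cont_op r lambda nu (J r lambda N m nu.+1) x -
  cont_op r lambda nu (J r lambda N m.-1 nu.+1) x.
Proof. by move=> h; rewrite cA_lt// -cont_opB. Qed.

(** Both options of the recursion contain the continuation value with [m.-1] rights. Taken out of
    the maximum, it leaves [gA] for using a right against [cA] for keeping it. *)
Lemma J_max_cA m nu x : (0 < m)%N -> (nu < N)%N ->
  J r lambda N m nu x = cont_op r lambda nu (J r lambda N m.-1 nu.+1) x +
    Num.max (gA x) (cA r lambda N m nu x).
Proof.
move=> m0 nuN; rewrite J_rec// cA_J// addr_maxr.
by rewrite [X in _ = Num.max X _]addrC [X in _ = Num.max _ X]addrC subrK.
Qed.

Lemma cont_op0 nu x : cont_op r lambda nu (fun=> 0) x = 0.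
Proof. by rewrite /cont_op !mulr0 addr0. Qed.

Lemma DeltaJ1 nu x : (nu < N)%N ->
  DeltaJ r lambda N 1 nu x = Num.max (gA x) (cA r lambda N 1 nu x).
Proof. by move=> h; rewrite /DeltaJ J_max_cA//= !J0 cont_op0 add0r subr0. Qed.

(** With [a = c^[m+1]] and [b = c^[m+2]], the increment is [a + max(g, b) - max(g, a)]; for [b <= a]
    this is [g] clamped to the interval from [b] to [a]. *)
Lemma DeltaJS m nu x : (nu < N)%N ->
  cA r lambda N m.+2 nu x <= cA r lambda N m.+1 nu x ->
  DeltaJ r lambda N m.+2 nu x =
  Num.max (cA r lambda N m.+2 nu x)
    (Num.min (gA x) (cA r lambda N m.+1 nu x)).
Proof.
move=> h cc; rewrite /DeltaJ (@J_max_cA m.+2)// (@J_max_cA m.+1)//=.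
have := @cA_J m.+1 nu x h; rewrite /=.
move: (cA _ _ _ m.+1 _ _) (cA _ _ _ m.+2 _ _) cc (gA x) => a b ab g e.
have -> : cont_op r lambda nu (J r lambda N m.+1 nu.+1) x =
  a + cont_op r lambda nu (J r lambda N m nu.+1) x by rewrite e subrK.
rewrite -addrA opprD addrACA [X in _ = X](_ : _ = a + (Num.max g b - Num.max g a)).
  by rewrite addrACA; lra.
by case: (leP g a); case: (leP g b); rewrite ?(max_r ab); lra.
Qed.

Lemma DeltaJ_terminal1 : DeltaJ r lambda N 1 N = gA.
Proof. by apply/funext => x; rewrite /DeltaJ J_terminal//= J0 subr0. Qed.

Lemma DeltaJ_terminalS m : DeltaJ r lambda N m.+2 N = fun=> 0.
Proof. by apply/funext => x; rewrite /DeltaJ !J_terminal//= subrr. Qed.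

(** Backward induction on the date, for all [m] at once. The ordering in [m] has to be carried
    along: the clamp formula [DeltaJS] at [nu] presupposes ordered continuation gains, that is, the
    ordering at [nu.+1] passed through [cont_op]. *)
Lemma slow_DeltaJ_anti nu : (nu <= N)%N -> forall m,
  slow (DeltaJ r lambda N m.+1 nu) /\
  forall x, 0 < x -> DeltaJ r lambda N m.+2 nu x <= DeltaJ r lambda N m.+1 nu x.
Proof.
have [k] := ubnP (N - nu)%N; elim: k nu => // k IH nu.
move=> kN; rewrite leq_eqVlt => /predU1P[->|nuN] m.
  rewrite DeltaJ_terminalS.
  case: m => [|m]; rewrite ?DeltaJ_terminal1 ?DeltaJ_terminalS.
    by split; [exact: slow_gA|move=> x x0; exact: slow_ge0 slow_gA x0].
  by split; [exact: slow_const0|].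
have {}IH j : slow (DeltaJ r lambda N j.+1 nu.+1) /\
  forall x, 0 < x ->
    DeltaJ r lambda N j.+2 nu.+1 x <= DeltaJ r lambda N j.+1 nu.+1 x.
  by apply: IH => //; lia.
have sc j : slow (cA r lambda N j.+1 nu).
  by apply: (eq_slow (slow_cont_op nu (IH j).1)) => x _; rewrite cA_lt.
have cc j x : 0 < x -> cA r lambda N j.+2 nu x <= cA r lambda N j.+1 nu x.
  by move=> x0; rewrite !cA_lt//; apply: le_cont_op => //; exact: (IH j).2.
have D2 j x : 0 < x -> DeltaJ r lambda N j.+2 nu x =
    Num.max (cA r lambda N j.+2 nu x) (Num.min (gA x) (cA r lambda N j.+1 nu x)).
  by move=> x0; rewrite DeltaJS ?cc.
(* The gain [c^[j+1]] separates consecutive increments: it lies above the increment of index [j.+2]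
   and below that of index [j.+1]. *)
have le_min_c j x : 0 < x -> DeltaJ r lambda N j.+2 nu x <= cA r lambda N j.+1 nu x.
  by move=> x0; rewrite D2// ge_max cc//= ge_min lexx orbT.
case: m => [|m]; split.
- by apply: (eq_slow (slow_max slow_gA (sc 0))) => x _; rewrite DeltaJ1.
- move=> x x0; rewrite (le_trans (le_min_c _ _ x0))// DeltaJ1//.
  by rewrite le_max lexx orbT.
- by apply: (eq_slow (slow_max (sc m.+1) (slow_min slow_gA (sc m)))) => x; exact: D2.
- by move=> x x0; rewrite (le_trans (le_min_c _ _ x0))// D2// le_max lexx.
Qed.

Lemma slow_cA m nu : (0 < m)%N -> slow (cA r lambda N m nu).
Proof.
case: m => // m _; case: (ltnP nu N) => nuN.
  apply: (@eq_slow _ _ (cont_op r lambda nu (DeltaJ r lambda N m.+1 nu.+1))).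
    by apply: slow_cont_op; case: (slow_DeltaJ_anti nuN m).
  by move=> x _; rewrite cA_lt.
by apply: (eq_slow slow_const0) => x _; rewrite /cA ltnNge nuN.
Qed.

Lemma cA_anti m nu x : (0 < m)%N -> 0 < x ->
  cA r lambda N m.+1 nu x <= cA r lambda N m nu x.
Proof.
case: m => // m _ x0; case: (ltnP nu N) => nuN; last by rewrite /cA ltnNge nuN.
by rewrite !cA_lt//; apply: le_cont_op => //; case: (slow_DeltaJ_anti nuN m).
Qed.

Lemma gA_ge1 x : 1 <= x -> gA x = x - 1.
Proof. by move=> x1; rewrite /gA /pos_part max_l// subr_ge0. Qed.

Lemma gA_le1 x : x <= 1 -> gA x = 0.
Proof. by move=> x1; rewrite /gA /pos_part max_r// subr_le0. Qed.

(* 1 + c(x) = O(x^a) with a = avg_exp nu < 1. *)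
Lemma cA_below_diagonal m nu : (0 < m)%N -> (nu <= N)%N ->
  exists2 x, 1 <= x & cA r lambda N m nu x <= x - 1.
Proof.
case: m => // m _; rewrite leq_eqVlt => /predU1P[->|nuN].
  by exists 1; rewrite // /cA ltnn subrr.
have sD := (slow_DeltaJ_anti nuN m).1.
set D := DeltaJ _ _ _ _ _ in sD; set a : R := avg_exp nu.
have a0 : 0 <= a := avg_exp_ge0 nu.
pose K := 1 + D 1; have K1 : 1 <= K by rewrite lerDl (slow_ge0 sD).
pose M := K * lambda `^ a.
have la1 : 1 <= lambda `^ a by rewrite -[leLHS](powRr0 lambda) ler_powR// ltW.
have M1 : 1 <= M by rewrite -[leLHS]mulr1 ler_pM.
have M0 : 0 < M by apply: lt_le_trans M1.
(* For this [x] one has [x^a = z = M^(nu+1)]. Both arguments of [D] are then at most [lambda^a * z],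
   so [1 + D] is at most [K * lambda^a * z = M * z = x] there. *)
exists (M `^ nu.+2%:R); first by rewrite powR_mulrn ?exprn_ege1// ltW.
rewrite cA_lt// /cont_op -/D -/a -powRrM.
have -> : nu.+2%:R * a = nu.+1%:R by rewrite /a /avg_exp mulrCA mulfV ?mulr1.
rewrite !powR_mulrn ?(ltW M0)//.
set z := M ^+ nu.+1; have z1 : 1 <= z by rewrite exprn_ege1.
have z0 : 0 < z by apply: lt_le_trans z1.
have bound c : 0 < c -> c <= lambda `^ a -> D (c * z) <= M * z - 1.
  move=> c0 cl; rewrite lerBrDl (le_trans (slow_le_max1 sD (mulr_gt0 c0 z0)))//.
  rewrite -/K /M -mulrA ler_pM2l ?(lt_le_trans _ K1)// ge_max.
  by rewrite ler_pM2r// cl -[1]mulr1 ler_pM.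
have -> : M ^+ nu.+2 - 1 = tilted_up r lambda * (M * z - 1) +
    tilted_down r lambda * (M * z - 1) by rewrite -mulrDl tilted_sum mul1r -exprS.
rewrite lerD// ler_wpM2l ?(ltW tilted_up_gt0) ?(ltW tilted_down_gt0)//.
  by rewrite bound ?powR_gt0// ler_powR ?(ltW lambda_gt1)// ge0_cp.
by rewrite bound ?powR_gt0.
Qed.

(** The infimum is attained. Every [y > x] exceeds a point of the defining set and so satisfies the
    inequality by [slow_upper]; [slow_closed] then lets [y] decrease to [x]. *)
Lemma bA_le m nu x : (0 < m)%N -> (nu <= N)%N ->
  (bA r lambda N m nu <= x%:E)%E <-> 1 <= x /\ cA r lambda N m nu x <= gA x.
Proof.
move=> m0 nuN; split; last first.
  by move=> [x1 xc]; apply: ereal_inf_lbound; exists x.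
move=> bx; have x1 : 1 <= x.
  rewrite -lee_fin (le_trans _ bx)//; apply: le_ereal_inf_tmp.
  by move=> _ [y [y1 _] <-]; rewrite lee_fin.
split=> //; rewrite gA_ge1//; apply: slow_closed; first exact: slow_cA.
  exact: lt_le_trans x1.
move=> y xy; have : (bA r lambda N m nu < y%:E)%E by rewrite (le_lt_trans bx)// lte_fin.
move=> /ereal_inf_lt[_ [z [z1 zc] <-]]; rewrite lte_fin => /ltW zy.
by apply: (slow_upper (slow_cA _ m0) z1 zy); rewrite -gA_ge1.
Qed.

Lemma bA_fin m nu : (0 < m)%N -> (nu <= N)%N -> (bA r lambda N m nu < +oo)%E.
Proof.
move=> m0 nuN; have [x x1 xc] := cA_below_diagonal m0 nuN.
by apply: (@le_lt_trans _ _ x%:E); rewrite ?ltry//; apply/bA_le; rewrite ?gA_ge1.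
Qed.

Lemma DA_ge1 m nu : (0 < m)%N -> (nu <= N)%N ->
  DA r lambda N m nu `&` `[1, +oo[ =
  [set x : R | (bA r lambda N m nu <= x%:E)%E].
Proof.
move=> m0 nuN; apply/seteqP; split=> x /=; rewrite in_itv/= andbT.
  by move=> [[_ xc] x1]; apply/bA_le.
by move=> /bA_le[]// x1 xc; split=> //; split=> //; exact: lt_le_trans x1.
Qed.

Lemma bA_anti m nu : (0 < m)%N -> (bA r lambda N m.+1 nu <= bA r lambda N m nu)%E.
Proof.
move=> m0; apply: le_ereal_inf => _ [x [x1 xc] <-]; exists x => //.
by split=> //; apply: le_trans xc; apply: cA_anti => //; exact: lt_le_trans x1.
Qed.

Lemma bA_terminal m : (0 < m)%N -> bA r lambda N m N = 1%E.
Proof.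
move=> m0; apply/eqP; rewrite eq_le; apply/andP; split.
  by apply/bA_le; rewrite // /cA ltnn gA_le1.
by apply: le_ereal_inf_tmp => _ [y [y1 _] <-]; rewrite lee_fin.
Qed.

End Thresholds.

(** * Exercising against holding at a single date *)

Section OneStep.
Context {R : realType}.
Variables (r lambda : R) (N : nat).
Hypotheses (lambda_gt1 : 1 < lambda) (lambda_r : lambda^-1 < 1 + r < lambda).
Set Implicit Arguments.
Unset Strict Implicit.
Implicit Types (x : R) (k m nu : nat).

(** The value 0 at the date [N] lets the terminal date obey the same formulas as the earlier
    ones. *)
Definition hold_value k nu x : R :=
  if (nu < N)%N then cont_op r lambda nu (J r lambda N k nu.+1) x else 0.

Lemma cA_hold k nu x : (nu <= N)%N -> cA r lambda N k nu x =
  hold_value k nu x - hold_value k.-1 nu x.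
Proof.
rewrite /hold_value; case: ltnP => [nuN _|Nnu _]; first exact: cA_J.
by rewrite /cA ltnNge Nnu subrr.
Qed.

Lemma J_hold k nu x : (0 < k)%N -> (nu <= N)%N -> J r lambda N k nu x =
  hold_value k.-1 nu x + Num.max (gA x) (cA r lambda N k nu x).
Proof.
move=> k0; rewrite leq_eqVlt => /predU1P[->|nuN].
  by rewrite J_terminal// /hold_value /cA ltnn add0r max_l// le_max lexx orbT.
by rewrite J_max_cA// /hold_value nuN.
Qed.

Lemma hold_value0 nu x : hold_value 0 nu x = 0.
Proof. by rewrite /hold_value J0; case: ifP => // _; rewrite cont_op0. Qed.

(** Here [k] and [k'] are the numbers of rights before and after the decision at [nu]. Their
    difference is 0 or 1, and each case is one entry of the maximum in [J_hold]. *)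
Lemma le_J_hold k k' nu x : (k' <= k <= k'.+1)%N -> (nu <= N)%N ->
  (k%:R - k'%:R) * gA x + hold_value k' nu x <= J r lambda N k nu x.
Proof.
case/andP=> k'k kk' nuN; case: (posnP k) k'k kk' => [->|k0].
  by rewrite leqn0 => /eqP-> _; rewrite J0 subrr mul0r add0r hold_value0.
move=> k'k kk'; rewrite J_hold//.
have [->|->] : k' = k \/ k' = k.-1 by lia.
  have -> : hold_value k nu x = hold_value k.-1 nu x + cA r lambda N k nu x.
    by rewrite cA_hold// addrC subrK.
  by rewrite subrr mul0r add0r lerD2l le_max lexx orbT.
rewrite -{1}(prednK k0) -natr1 addrAC subrr add0r mul1r addrC lerD2l.
by rewrite le_max lexx.
Qed.

(** By [bA_le], the threshold test selects the larger entry of the maximum in [J_hold]. *)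
Lemma eq_J_hold k k' nu x : 0 < x -> (k' <= k <= k'.+1)%N -> (nu <= N)%N ->
  (k' < k)%N = (0 < k)%N && (bA r lambda N k nu <= x%:E)%E ->
  (k%:R - k'%:R) * gA x + hold_value k' nu x = J r lambda N k nu x.
Proof.
move=> x0 /andP[k'k kk'] nuN; case: (posnP k) k'k kk' => [->|k0].
  by rewrite leqn0 => /eqP-> _ _; rewrite J0 subrr mul0r add0r hold_value0.
move=> k'k kk' /= rule; rewrite J_hold//.
have [ek'|ek'] : k' = k \/ k' = k.-1 by lia.
  have -> : hold_value k' nu x = hold_value k.-1 nu x + cA r lambda N k nu x.
    by rewrite ek' cA_hold// addrC subrK.
  rewrite ek' subrr mul0r add0r max_r//; move: rule; rewrite ek' ltnn.
  (* Below 1 the threshold is never reached, and holding attains the maximum because [gA] vanishes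
     while [cA] is nonnegative. *)
  have [x1|/ltW x1 _] := leP 1 x; last first.
    by rewrite gA_le1//; apply: slow_ge0 x0; apply: slow_cA.
  by apply: contraPT; rewrite -ltNge => /ltW xc; rewrite (_ : (_ <= _)%E)//; apply/bA_le.
have : (bA r lambda N k nu <= x%:E)%E by rewrite -rule ek' prednK.
move=> /bA_le[]// _ xc; rewrite max_l// ek' -{1}(prednK k0) -natr1.
by rewrite addrAC subrr add0r mul1r addrC.
Qed.

End OneStep.

Section ExerciseCounting.
Context {N : nat} {T : Type}.
Variables (m : nat) (sigma : nat -> T -> date N).
Set Implicit Arguments.
Unset Strict Implicit.
Implicit Types (w : T) (nu : nat).

Definition before (s : date N) nu : bool :=
  if s is Some k then (k < nu)%N else false.

(** The state variable [k_nu]; a right that is never exercised stays counted at every date. *)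
Definition remaining nu w : nat :=
  \sum_(1 <= i < m.+1) ~~ before (sigma i w) nu.

Lemma remaining0 w : remaining 0 w = m.
Proof.
rewrite /remaining (eq_bigr (fun=> 1%N)); last by move=> i _; case: (sigma i w).
by rewrite sum_nat_const_nat subn1 muln1.
Qed.

(** The pathwise clause of [admissible] at a single outcome. *)
Definition nested (s : nat -> date N) := exists l, [/\ (l <= m)%N,
  forall i, (1 <= i <= m)%N -> isSome (s i) = (m - l < i)%N &
  forall i, (m - l < i < m)%N -> date_lt (s i.+1) (s i)].

(** The members of an upward closed set of indices come last, so the number of non-members locates
    the cut. In the induction, if [n.+1] is outside, so is every smaller index. *)
Lemma count_upper n (A : pred nat) : (forall i, (0 < i < n)%N -> A i -> A i.+1) ->
  (\sum_(1 <= j < n.+1) ~~ A j <= n)%N /\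
  forall i, (1 <= i <= n)%N -> A i = (\sum_(1 <= j < n.+1) ~~ A j < i)%N.
Proof.
elim: n => [|n IH] up; first by rewrite big_nil; split=> // i; lia.
have [|kn ik] := IH; first by move=> i ?; apply: up; lia.
rewrite big_nat_recr//=; set k := (\sum_(1 <= j < n.+1) _)%N in kn ik *.
have [An|An] := boolP (A n.+1).
  rewrite addn0; split=> [|i ?]; first by lia.
  have [->|] := eqVneq i n.+1; first by rewrite An; lia.
  by move=> ?; apply: ik; lia.
have kE : k = n.
  case: (posnP n) => n0; first by lia.
  have : A n = false by apply/negbTE; apply: contra An; apply: up; lia.
  by rewrite ik; lia.
rewrite kE /= addn1; split=> // i ?; have [->|ne] := eqVneq i n.+1.
  by rewrite (negbTE An) ltnn.
by rewrite ik ?kE; lia.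
Qed.

(** Rights are used from the highest index down, so those used before [nu] form an upper set of
    indices, to which [count_upper] applies. *)
Lemma before_remaining nu w i : nested (sigma ^~ w) -> (1 <= i <= m)%N ->
  before (sigma i w) nu = (remaining nu w < i)%N.
Proof.
move=> [l [lm Si lt]] im; rewrite /remaining.
have [|_ <- //] := @count_upper m (fun i => before (sigma i w) nu).
move=> {im}i im b.
have lti : (m - l < i)%N by rewrite -Si; [case: (sigma i w) b|lia].
have := lt i; rewrite lti => /(_ _); case/andP: im => i0 ->.
move=> /(_ isT); move: b; rewrite /before /date_lt.
by case: (sigma i w) => // a; case: (sigma i.+1 w) => // b; lia.
Qed.

Lemma remaining_le nu w : (remaining nu w <= m)%N.
Proof.
rewrite /remaining -[leqRHS](remaining0 w); apply: leq_sum => i _.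
by case: before => //; case: (sigma i w).
Qed.

(** Exercise dates are strictly increasing. If two rights were used at [nu], then those of index [k]
    and [k.-1] would share this date. *)
Lemma remaining_step nu w : nested (sigma ^~ w) ->
  (remaining nu.+1 w <= remaining nu w <= (remaining nu.+1 w).+1)%N.
Proof.
move=> nw; have km := remaining_le nu w; have k'm := remaining_le nu.+1 w.
have B i : before (sigma i w) nu -> before (sigma i w) nu.+1.
  by rewrite /before; case: (sigma i w) => // a; lia.
apply/andP; split; first last.
  rewrite leqNgt; apply/negP => lt; set k := remaining nu w in lt km *.
  have [l [lm Si ltd]] := nw.
  have at_nu i : (remaining nu.+1 w < i <= k)%N ->
      exists2 a : 'I_N.+1, sigma i w = Some a & a = nu :> nat.
    move=> ik; have bi' : before (sigma i w) nu.+1.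
      by rewrite before_remaining//; lia.
    have : before (sigma i w) nu = false by rewrite before_remaining//; lia.
    by move: bi'; rewrite /before; case: (sigma i w) => // a; exists a => //; lia.
  have [|a ea anu] := at_nu k; first by lia.
  have [|b eb bnu] := at_nu k.-1; first by lia.
  have := ltd k.-1; rewrite -Si ?eb; last by lia.
  have k0 : (0 < k)%N by lia.
  by rewrite prednK// ea /= => /(_ _); lia.
rewrite leqNgt; apply/negP => lt.
have : before (sigma (remaining nu.+1 w) w) nu by rewrite before_remaining//; lia.
by move=> /B; rewrite before_remaining ?ltnn//; lia.
Qed.

End ExerciseCounting.

(** * Dynamics of the ratio and one step of the wealth process *)

Section Dynamics.
Context {d : measure_display} {T : measurableType d} {R : realType}.
Variables (r : R) (N : nat) (S : nat -> T -> R).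
Hypothesis S_gt0 : forall nu w, 0 < S nu w.
Set Implicit Arguments.
Unset Strict Implicit.
Implicit Types (w : T) (nu : nat).

Lemma geo_mean_gt0 nu w : 0 < geo_mean S nu w.
Proof. by rewrite powR_gt0// prodr_gt0. Qed.

Lemma ratio_gt0 nu w : 0 < Defs.ratio S nu w.
Proof. by rewrite divr_gt0 ?geo_mean_gt0. Qed.

Definition agree nu w w' := forall j, (j <= nu)%N -> S j w = S j w'.

Lemma agree_sym nu w w' : agree nu w w' -> agree nu w' w.
Proof. by move=> a j jnu; rewrite a. Qed.

Lemma eq_geo_mean nu w w' : agree nu w w' -> geo_mean S nu w = geo_mean S nu w'.
Proof.
move=> a; congr (_ `^ _); apply: eq_big_nat => j /andP[_ jnu].
exact: a.
Qed.

(** With [A = avg_exp nu], the new mean is [G^A * (u * S)^(1 - A)]; dividing by the new price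
    [u * S] leaves [u^(-A) * (G / S)^A]. The ratio thus evolves autonomously, as encoded in
    [cont_op]. *)
Lemma ratio_step nu w w' u : 0 < u -> agree nu w w' ->
  S nu.+1 w' = u * S nu w ->
  Defs.ratio S nu.+1 w' = u `^ (- avg_exp nu) * Defs.ratio S nu w `^ avg_exp nu.
Proof.
move=> u0 a e; have Sw := S_gt0 nu w; set A : R := avg_exp nu.
have uS : 0 < u * S nu w by rewrite mulr_gt0.
have G : geo_mean S nu.+1 w' =
    geo_mean S nu w `^ A * (u * S nu w) `^ (nu.+2%:R^-1).
  rewrite /geo_mean big_nat_recr//= e.
  rewrite -(eq_big_nat _ _ (_ : forall j, (0 <= j < nu.+1)%N -> S j w = S j w')).
    rewrite powRM ?(ltW uS) ?prodr_ge0// -?powRrM /A /avg_exp ?mulKf// => j _.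
    by rewrite ltW.
  by move=> j /andP[_ jnu]; exact: a.
rewrite /Defs.ratio G e -mulrA -{2}(powRr1 (ltW uS)) -powRN -powRD; last first.
  by rewrite (gt_eqF uS) implybT.
rewrite (_ : _ - 1 = - A); last by rewrite /A avg_expE opprB.
rewrite !powRM ?ltW ?geo_mean_gt0 ?invr_gt0// mulrCA; congr (_ * (_ * _)).
by rewrite -(powR_inv1 (ltW Sw)) -powRrM mulN1r.
Qed.

Lemma scaled_gA nu w :
  S nu w * gA (Defs.ratio S nu w) = pos_part (geo_mean S nu w - S nu w).
Proof.
rewrite /gA /pos_part maxr_pMr ?ltW// mulr0 mulrBr mulr1 /Defs.ratio.
by rewrite mulrCA mulfV ?mulr1// gt_eqF.
Qed.

Variables (m : nat) (sigma : nat -> T -> date N).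
Local Notation remaining := (remaining m sigma).

Definition payoff nu w : R :=
  discount r ^+ nu * pos_part (geo_mean S nu w - S nu w).

(** Exercises strictly before [nu], in step with [remaining]: a payoff collected at [nu] appears on
    passing to [nu.+1]. *)
Definition past nu w : R := \sum_(1 <= i < m.+1)
  if sigma i w is Some k then payoff k w *+ (k < nu)%N else 0.

Lemma past_step nu w : past nu.+1 w =
  past nu w + ((remaining nu w)%:R - (remaining nu.+1 w)%:R) * payoff nu w.
Proof.
rewrite /past /remaining !natr_sum -sumrB big_distrl -big_split/=.
apply: eq_bigr => i _; rewrite /before.
case: (sigma i w) => [k|]; last by rewrite subrr mul0r addr0.
rewrite ltnS; case: (ltngtP k nu) => [||->] /=;
  by rewrite ?subrr ?mulr1n ?mulr0n ?mul0r ?addr0 ?subr0 ?mul1r ?add0r.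
Qed.

Lemma past_end w : past N.+1 w = reward r S m sigma w.
Proof.
by apply: eq_bigr => i _; case: (sigma i w) => // k; rewrite ltn_ord.
Qed.

Lemma past0 w : past 0 w = 0.
Proof. by rewrite /past big1// => i _; case: (sigma i w). Qed.

(** What two outcomes with a common price history share under an admissible vector; it determines
    [past] and [remaining] at [nu.+1]. *)
Definition on_path nu w w' := [/\ agree nu w w' &
  forall i j, (1 <= i <= m)%N -> (j <= nu)%N ->
    before (sigma i w) j.+1 = before (sigma i w') j.+1].

Lemma eq_remaining nu w w' : on_path nu w w' ->
  remaining nu.+1 w = remaining nu.+1 w'.
Proof.
by move=> [_ b]; apply: eq_big_nat => i ?; rewrite b//; lia.
Qed.

Lemma eq_past nu w w' : on_path nu w w' -> past nu.+1 w = past nu.+1 w'.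
Proof.
move=> [a b]; apply: eq_big_nat => i im.
have pay k : (k <= nu)%N -> payoff k w = payoff k w'.
  move=> knu; rewrite /payoff a// (@eq_geo_mean k w w')// => j jk.
  by apply: a; lia.
have {}b j : (j <= nu.+1)%N -> before (sigma i w) j = before (sigma i w') j.
  case: j => [|j] jnu; first by rewrite /before; do 2!case: sigma.
  by apply: b; lia.
move: b; rewrite /before; case: (sigma i w) => [k|]; case: (sigma i w') => [k'|] b //.
- case: (ltnP k nu.+1) (b nu.+1 (leqnn _)) => knu <-; last by rewrite !mulr0n.
  (* The [before] tests around [k] and [k'] force the two exercise dates to coincide. *)
  suff kk' : k = k' :> nat by rewrite kk' pay// -kk'.
  by have := b k.+1; have := b k; have := b k'.+1; have := b k'; have := b nu.+1; lia.
- by rewrite b.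
- by rewrite -b.
Qed.

Variable lambda : R.
Hypotheses (lambda_gt1 : 1 < lambda) (lambda_r : lambda^-1 < 1 + r < lambda).

(** The supermartingale of the optimality proof. The payoff is the price times a function of the
    ratio, so the value to go is the price times [J] at the ratio. *)
Definition wealth nu w : R := past nu w +
  discount r ^+ nu * S nu w * J r lambda N (remaining nu w) nu (Defs.ratio S nu w).

(** The mean over the up-successor [w1] and the down-successor [w0]. One discount factor and the
    price move turn [p] and [q] into the tilted weights of [cont_op]. *)
Lemma wealth_step nu w w1 w0 : (nu < N)%N ->
  on_path nu w w1 -> on_path nu w w0 ->
  S nu.+1 w1 = lambda * S nu w -> S nu.+1 w0 = lambda^-1 * S nu w ->
  up_prob r lambda * wealth nu.+1 w1 + down_prob r lambda * wealth nu.+1 w0 =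
  past nu.+1 w + discount r ^+ nu * S nu w *
    hold_value r lambda N (remaining nu.+1 w) nu (Defs.ratio S nu w).
Proof.
move=> nuN p1 p0 e1 e0; have l0 : 0 < lambda by apply: lt_trans lambda_gt1.
have li0 : 0 < lambda^-1 by rewrite invr_gt0.
rewrite /wealth -(eq_past p1) -(eq_past p0) -(eq_remaining p1) -(eq_remaining p0).
rewrite (ratio_step l0 p1.1 e1) (ratio_step li0 p0.1 e0) e1 e0.
rewrite /hold_value nuN /cont_op /tilted_up /tilted_down.
have -> a : lambda^-1 `^ (- a) = lambda `^ a.
  by rewrite -(powR_inv1 (ltW l0)) -powRrM mulN1r opprK.
move: (J _ _ _ _ _ _) (J _ _ _ _ _ _) => a b; rewrite /down_prob exprSr; ring.
Qed.

Lemma wealth_gain nu w : past nu.+1 w + discount r ^+ nu * S nu w *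
    hold_value r lambda N (remaining nu.+1 w) nu (Defs.ratio S nu w) =
  past nu w + discount r ^+ nu * S nu w *
    (((remaining nu w)%:R - (remaining nu.+1 w)%:R) * gA (Defs.ratio S nu w) +
     hold_value r lambda N (remaining nu.+1 w) nu (Defs.ratio S nu w)).
Proof. by rewrite past_step /payoff -scaled_gA; ring. Qed.

(** For [nu < N] the left side is the one-step mean of [wealth_step]; for [nu = N] it is the total
    reward. One inequality thus covers the supermartingale step and the end of the horizon. *)
Lemma le_wealth nu w : nested m (sigma ^~ w) -> (nu <= N)%N ->
  past nu.+1 w + discount r ^+ nu * S nu w *
    hold_value r lambda N (remaining nu.+1 w) nu (Defs.ratio S nu w) <= wealth nu w.
Proof.
move=> nw nuN; rewrite wealth_gain lerD2l ler_wpM2l//.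
  apply: mulr_ge0 (ltW (S_gt0 _ _)); apply: exprn_ge0; apply: ltW.
  exact: discount_gt0 lambda_gt1 lambda_r.
by apply: le_J_hold => //; exact: remaining_step.
Qed.

Lemma eq_wealth nu w : nested m (sigma ^~ w) -> (nu <= N)%N ->
  (let k := remaining nu w in
   (remaining nu.+1 w < k)%N =
     (0 < k)%N && (bA r lambda N k nu <= (Defs.ratio S nu w)%:E)%E) ->
  past nu.+1 w + discount r ^+ nu * S nu w *
    hold_value r lambda N (remaining nu.+1 w) nu (Defs.ratio S nu w) = wealth nu w.
Proof.
move=> nw nuN rule; rewrite wealth_gain (eq_J_hold _ _ _ _ _ rule)//.
- exact: ratio_gt0.
- exact: remaining_step.
Qed.

End Dynamics.

(** * First dates at which a predicate holds *)

Section EntryRule.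
Context {N : nat}.
Set Implicit Arguments.
Unset Strict Implicit.
Implicit Types Q : pred 'I_N.+1.

Lemma first_date_spec Q :
  match first_date Q with
  | Some k => Q k /\ forall j : 'I_N.+1, (j < k)%N -> ~~ Q j
  | None => forall j, ~~ Q j
  end.
Proof.
rewrite /first_date.
have : forall j, Q j -> j \in [seq nu <- enum 'I_N.+1 | Q nu].
  by move=> j Qj; rewrite mem_filter Qj mem_enum.
have : all Q [seq nu <- enum 'I_N.+1 | Q nu] by exact: filter_all.
have : sorted ltn [seq val nu | nu <- [seq nu <- enum 'I_N.+1 | Q nu]].
  apply: (subseq_sorted ltn_trans) (iota_ltn_sorted 0 N.+1).
  by rewrite -val_enum_ord map_subseq// filter_subseq.
set s := [seq _ <- _ | _]; case: s => [|k s] /= so al mem.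
  by move=> j; apply/negP => /mem.
case/andP: al => Qk _; split=> // j jk; apply/negP => /mem.
rewrite inE => /predU1P[jE|js]; first by rewrite jE ltnn in jk.
have := order_path_min ltn_trans so => /allP /(_ (val j) (map_f _ js)) /=.
by rewrite ltnNge ltnW.
Qed.

Lemma before_first_date Q nu :
  before (first_date Q) nu = [exists j : 'I_N.+1, (j < nu)%N && Q j].
Proof.
have := first_date_spec Q; rewrite /before; case: first_date => [k [Qk kmin]|noQ].
  apply/idP/existsP => [knu|[j /andP[jnu Qj]]]; first by exists k; rewrite knu.
  rewrite ltnNge; apply/negP => nuk; have := kmin j (leq_trans jnu nuk).
  by rewrite Qj.
by apply/esym/existsP => -[j /andP[_]]; rewrite (negbTE (noQ j)).
Qed.

Lemma before_firstS Q (k : 'I_N.+1) : ~~ before (first_date Q) k ->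
  before (first_date Q) k.+1 = Q k.
Proof.
rewrite !before_first_date => /existsPn no.
apply/existsP/idP => [[j /andP[]]|Qk]; last by exists k; rewrite leqnn.
rewrite ltnS leq_eqVlt => /orP[/eqP jk Qj|jk Qj].
  by rewrite -(val_inj jk).
by have := no j; rewrite jk Qj.
Qed.

End EntryRule.

(** * The entry rule along a path *)

Section SigmaStar.
Context {d : measure_display} {T : measurableType d} {R : realType}.
Variables (r lambda : R) (N : nat) (S : nat -> T -> R) (m : nat).
Set Implicit Arguments.
Unset Strict Implicit.
Implicit Types (w : T) (i nu : nat).

Let b := bA r lambda N.
Let Rt := Defs.ratio S.
Let sigma := sigma_star r lambda S N m.

(** Merges the two cases of [entry_rule]: the guard is void for [i = m], and otherwise [before] is
    the strict comparison of dates. *)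
Lemma sigma_starE i w : (1 <= i <= m)%N -> sigma i w =
  first_date (fun nu : 'I_N.+1 =>
    ((i < m)%N ==> before (sigma i.+1 w) nu) && (b i nu <= (Rt nu w)%:E)%E).
Proof.
move=> /andP[i0 im]; rewrite /sigma /sigma_star.
case: (ltnP i m) => lim; last first.
  have -> : i = m by lia.
  by rewrite subnn.
rewrite -(subnSK lim) /=; congr first_date; apply/funext => nu.
by rewrite (_ : (m - (m - i.+1).+1)%N = i)//; lia.
Qed.

Lemma sigma_star_lt i w : (1 <= i < m)%N -> isSome (sigma i w) ->
  date_lt (sigma i.+1 w) (sigma i w).
Proof.
move=> im; rewrite sigma_starE; last by lia.
case/andP: im => _ im; set Q := fun _ => _.
have := first_date_spec Q; case: first_date => // k [+ _] _.
by rewrite /Q im /= => /andP[].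
Qed.

(** A finite coordinate requires a finite, earlier predecessor, so the finite ones form an upper set
    of indices; the cut comes from [count_upper]. *)
Lemma nested_sigma_star w : nested m (sigma ^~ w).
Proof.
have up i : (0 < i < m)%N -> isSome (sigma i w) -> isSome (sigma i.+1 w).
  by move=> im /(sigma_star_lt im); case: (sigma i.+1 w).
have [] := count_upper up.
set k := (\sum_(1 <= j < m.+1) _)%N => km kE.
exists (m - k)%N; rewrite subKn//; split=> [|//|i /andP[ki im]].
  exact: leq_subr.
by apply: sigma_star_lt; [lia|rewrite kE//; lia].
Qed.

Lemma sigma_star_rule nu w : (nu <= N)%N ->
  let k := remaining m sigma nu w in
  (remaining m sigma nu.+1 w < k)%N =
    (0 < k)%N && (b k nu <= (Rt nu w)%:E)%E.
Proof.
move=> nuN k; have nw := nested_sigma_star w.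
case: (posnP k) => [->|k0]; first by rewrite ltn0.
have km : (k <= m)%N := remaining_le _ _ _ _.
have kk : (1 <= k <= m)%N by rewrite k0.
rewrite -(before_remaining nu.+1 nw kk).
have nb : before (sigma k w) nu = false.
  by rewrite (before_remaining nu nw kk) ltnn.
have -> : nu = Ordinal (nuN : (nu < N.+1)%N) by [].
move: nb; rewrite sigma_starE// => nb; rewrite before_firstS /= ?nb//.
case: (ltnP k m) => //= klm; have kk1 : (1 <= k.+1 <= m)%N by [].
by rewrite (before_remaining nu nw kk1) ltnSn.
Qed.

End SigmaStar.

(** * The natural filtration: saturation, stopping times and measurability *)

Section Filtration.
Context {d : measure_display} {T : measurableType d} {R : realType}.
Variables (S : nat -> T -> R).
Set Implicit Arguments.
Unset Strict Implicit.
Implicit Types (w : T) (nu : nat) (A : set T).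

Let F := natural_filtration S.

Definition generators nu : set (set T) :=
  \bigcup_(j in [set j | (j <= nu)%N]) preimage_set_system setT (S j) measurable.

Lemma filtration_le nu nu' : (nu <= nu')%N -> F nu `<=` F nu'.
Proof.
move=> nn; apply: sub_sigma_algebra2 => A [j /= jnu SA]; exists j => //=.
exact: leq_trans nn.
Qed.

(* The F_nu-measurable sets are unions of fibres of (S_0, ..., S_nu). *)
Lemma filtration_agree nu A w w' : F nu A -> agree S nu w w' -> A w -> A w'.
Proof.
(* The sets saturated under [agree] form a sigma-algebra that contains the generators. *)
suff : F nu `<=` [set A | forall w w', agree S nu w w' -> A w -> A w'].
  by move=> FA /FA/[apply]; apply.
apply: smallest_sub.
  split=> [//|B BE|B BE] v v' a.
    by move=> [_ nB]; split=> // Bv'; apply/nB/(BE _ _ _ Bv')/agree_sym.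
  by move=> [k _ Bv]; exists k => //; apply: BE Bv.
move=> B [j /= jnu [C mC <-]] v v' a [_ /= Cv]; split=> //=.
by rewrite -a.
Qed.

Lemma filtration_measurable nu A : (forall j, measurable_fun setT (S j)) ->
  F nu A -> measurable A.
Proof.
move=> mS; apply: smallest_sub; first exact: sigma_algebra_measurable.
by move=> B [j _ [C mC <-]]; exact: mS.
Qed.

Local Notation TF nu := (g_sigma_algebraType (generators nu)).

Lemma adapted j nu : (j <= nu)%N ->
  measurable_fun setT (S j : TF nu -> R).
Proof.
move=> jnu _ C mC; apply: sub_sigma_algebra; exists j => //=.
by exists C.
Qed.

Lemma measurable_geo_mean d' (T' : measurableType d') (f : T' -> T) nu :
  (forall j, (j <= nu)%N -> measurable_fun setT (S j \o f)) ->
  measurable_fun setT (geo_mean S nu \o f).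
Proof.
move=> mS; apply: (measurableT_comp (measurable_powR _)).
apply: (measurable_prod (h := fun j => S j \o f)) => j.
by rewrite mem_index_iota => /andP[_ jnu]; exact: mS.
Qed.

Lemma measurable_ratio d' (T' : measurableType d') (f : T' -> T) nu :
  (forall j w, 0 < S j w) ->
  (forall j, (j <= nu)%N -> measurable_fun setT (S j \o f)) ->
  measurable_fun setT (Defs.ratio S nu \o f).
Proof.
move=> S0 mS.
(* Division by a positive price is rewritten as the measurable power of exponent -1. *)
have -> : Defs.ratio S nu \o f =
    (geo_mean S nu \o f) \* ((fun x => x `^ (-1)) \o (S nu \o f)).
  by apply/funext => w /=; rewrite powR_inv1// ltW.
apply: measurable_funM; first exact: measurable_geo_mean.
by apply: (measurableT_comp (measurable_powR _)); exact: mS.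
Qed.

Lemma filtration_ratio nu (b : \bar R) : (forall j w, 0 < S j w) ->
  F nu [set w | (b <= (Defs.ratio S nu w)%:E)%E].
Proof.
move=> S0; have mR : measurable_fun setT (Defs.ratio S nu : TF nu -> R).
  by apply: (@measurable_ratio _ (TF nu) id) => // j; exact: adapted.
case: b => [c| |].
- have := mR measurableT _ (measurable_itv `[c, +oo[); rewrite setTI.
  set B := _ @^-1` _; rewrite (_ : [set _ | _] = B)//.
  by apply/seteqP; split=> w; rewrite /B /= in_itv/= andbT lee_fin.
- rewrite (_ : [set _ | _] = set0); first exact: sigma_algebra0.
  by apply/seteqP; split=> w //=; rewrite leye_eq.
- rewrite (_ : [set _ | _] = setT); first exact: (@measurableT _ (TF nu)).
  by apply/seteqP; split=> w //= _; rewrite leNye.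
Qed.

Variable N : nat.

Lemma leq_date_before (tau : T -> date N) nu :
  [set w | if tau w is Some k then (k <= nu)%N else false] =
  [set w | before (tau w) nu.+1].
Proof. by apply/seteqP; split=> w /=; rewrite /before; case: (tau w). Qed.

(** The comparison in [before] is strict, so information up to [nu.-1] suffices; at [nu = 0] the
    event is empty. *)
Lemma stopping_before nu tau : (nu <= N.+1)%N -> @stopping_time d T N F tau ->
  F nu.-1 [set w | before (tau w) nu].
Proof.
case: nu => [_ _|nu nuN st]; last by rewrite -leq_date_before; exact: st.
rewrite (_ : [set _ | _] = set0); first exact: sigma_algebra0.
by apply/seteqP; split=> w //=; case: (tau w).
Qed.

Lemma stopping_first_date (Q : T -> pred 'I_N.+1) :
  (forall j : 'I_N.+1, F j [set w | Q w j]) ->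
  stopping_time F (fun w => first_date (Q w)).
Proof.
move=> FQ nu nuN.
rewrite leq_date_before.
have -> : [set w | before (first_date (Q w)) nu.+1] =
    \big[setU/set0]_(j < N.+1 | (j <= nu)%N) [set w | Q w j].
  rewrite -bigcup_seq_cond; apply/seteqP; split=> w /=; rewrite before_first_date.
    by move=> /existsP[j /andP[jnu Qj]]; exists j => //=; rewrite mem_index_enum.
  by move=> [j /= /andP[_ jnu] Qj]; apply/existsP; exists j; rewrite ltnS jnu.
apply: (@bigsetU_measurable _ (TF nu)) => j jnu.
exact: filtration_le jnu _ (FQ j).
Qed.

(** Induction from [m] downwards: at the date [j] the guard only asks whether the preceding right
    was used strictly before [j], an event of [F j.-1]. *)
Lemma stopping_sigma_star r lambda m i : (forall j w, 0 < S j w) ->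
  (1 <= i <= m)%N -> stopping_time F (sigma_star r lambda S N m i).
Proof.
move=> S0; have [n] := ubnP (m - i)%N; elim: n i => // n IH i mn im.
rewrite (_ : sigma_star _ _ _ _ _ _ =
    fun w => first_date (fun nu : 'I_N.+1 =>
      ((i < m)%N ==> before (sigma_star r lambda S N m i.+1 w) nu) &&
      (bA r lambda N i nu <= (Defs.ratio S nu w)%:E)%E)); last first.
  by apply/funext => w; exact: sigma_starE.
apply: stopping_first_date => j.
rewrite (_ : [set _ | _] =
  [set w | (i < m)%N ==> before (sigma_star r lambda S N m i.+1 w) j] `&`
  [set w | (bA r lambda N i j <= (Defs.ratio S j w)%:E)%E]); last first.
  by apply/seteqP; split=> w /= => [/andP[]|[-> ->]].
apply: (@measurableI _ (TF j)); last exact: filtration_ratio.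
case: ltnP => lim /=; last first.
  rewrite (_ : [set _ | _] = setT); first exact: (@measurableT _ (TF j)).
  by apply/seteqP; split.
apply: (@filtration_le j.-1); first exact: leq_pred.
by apply: stopping_before; [exact: ltnW|apply: IH; lia].
Qed.

Lemma admissible_sigma_star r lambda m : (forall j w, 0 < S j w) ->
  admissible F m (sigma_star r lambda S N m).
Proof.
move=> S0; split=> [i im|w]; first exact: stopping_sigma_star.
exact: nested_sigma_star.
Qed.

(** Decisions up to [nu] are events of the filtration, hence unions of price-history fibres. *)
Lemma on_path_agree m (sigma : nat -> T -> date N) nu w w' :
  admissible F m sigma -> (nu <= N)%N -> agree S nu w w' ->
  on_path S m sigma nu w w'.
Proof.
move=> [st _] nuN a; split=> // i j im jnu.
have aj : agree S j w w' by move=> k kj; apply: a; lia.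
have Fj : F j [set v | before (sigma i v) j.+1].
  by rewrite -leq_date_before; apply: st => //; lia.
apply/idP/idP => h; first exact: (filtration_agree Fj aj).
exact: (filtration_agree Fj (agree_sym aj)).
Qed.

Lemma measurable_reward r m (sigma : nat -> T -> date N) :
  (forall j, measurable_fun setT (S j)) -> admissible F m sigma ->
  measurable_fun setT (reward r S m sigma).
Proof.
move=> mS [st _].
(* Decomposition over the finitely many exercise dates. Indices outside [1..m], about which
   admissibility says nothing, are set to zero so that every summand is measurable. *)
have -> : reward r S m sigma = fun w => \sum_(1 <= i < m.+1) \sum_(k < N.+1)
    (if (0 < i <= m)%N then \1_[set w | sigma i w = Some k] w else 0) * payoff r S k w.
  apply/funext => w; apply: eq_big_nat => i; rewrite ltnS => im; rewrite im.
  case E: (sigma i w) => [k|]; last first.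
    by rewrite big1// => k _; rewrite indicE memNset ?mul0r//= E.
  rewrite (bigD1 k)//= big1 ?addr0 => [|j jk].
    by rewrite indicE mem_set ?mul1r.
  by rewrite indicE memNset ?mul0r//= E => -[kj]; rewrite kj eqxx in jk.
have mb i nu : (0 < i <= m)%N -> (nu <= N.+1)%N ->
    measurable [set w | before (sigma i w) nu].
  move=> im nuN; apply: (filtration_measurable mS).
  by apply: stopping_before => //; exact: st.
have mI i (k : 'I_N.+1) : measurable_fun setT
    (fun w => if (0 < i <= m)%N then \1_[set w | sigma i w = Some k] w else 0 : R).
  case: (boolP (0 < i <= m)%N) => im; last exact: measurable_cst.
  apply: measurable_indic.
  rewrite (_ : [set _ | _] = [set w | before (sigma i w) k.+1] `\`
                             [set w | before (sigma i w) k]).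
    by apply: measurableD; apply: mb => //; exact: ltnW.
  apply/seteqP; split=> w /=; first by move=> ->; rewrite /= ltnSn ltnn.
  rewrite /before; case: (sigma i w) => [k'|] [] // h1 h2.
  by congr Some; apply: val_inj => /=; lia.
apply: measurable_sum => i; apply: measurable_sum => k.
apply: measurable_funM; first exact: mI.
apply: measurable_funM; first exact: measurable_cst.
apply: (measurable_maxr (f := fun w => geo_mean S k w - S k w)).
  apply: measurable_funB => //.
  by apply: (@measurable_geo_mean _ T id) => j _; exact: mS.
exact: measurable_cst.
Qed.

End Filtration.

(** * Sign cylinders and expectations as recursions on the binary tree *)

Section Cylinders.
Context {d : measure_display} {T : measurableType d} {R : realType}.
Variables (P : probability T R) (N : nat) (p q : R) (eps : nat -> {RV P >-> R}).
Hypotheses (p_gt0 : 0 < p) (q_gt0 : 0 < q) (pq1 : p + q = 1).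
Hypothesis eps_iid : iid_signs N p q eps.
Set Implicit Arguments.
Unset Strict Implicit.
Implicit Types (s : bitseq) (b : bool) (w : T).

Definition sign_of b : R := if b then 1 else -1.

Definition sign_prob b : R := if b then p else q.

Definition path_prob s : R := \prod_(b <- s) sign_prob b.

(** Signs are numbered from 1 and list entries from 0, whence the shift. *)
Definition cylinder s : set T :=
  [set w | forall k, (k < size s)%N -> eps k.+1 w = sign_of (nth true s k)].

Lemma cylinder_rcons s b :
  cylinder (rcons s b) = cylinder s `&` eps (size s).+1 @^-1` [set sign_of b].
Proof.
apply/seteqP; split=> w /=.
  move=> H; split=> [k ks|]; last first.
    by have := H (size s); rewrite size_rcons nth_rcons ltnn eqxx; apply.
  by have := H k; rewrite size_rcons nth_rcons ks; apply; exact: ltnW.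
move=> [H e] k; rewrite size_rcons ltnS leq_eqVlt => /orP[/eqP->|ks].
  by rewrite nth_rcons ltnn eqxx.
by rewrite nth_rcons ks; exact: H.
Qed.

Lemma cylinder_nil : cylinder [::] = setT.
Proof. by apply/seteqP; split. Qed.

Lemma measurable_cylinder s : measurable (cylinder s).
Proof.
elim/last_ind: s => [|s b IH]; first by rewrite cylinder_nil.
by rewrite cylinder_rcons; apply: measurableI.
Qed.

Lemma prob_cylinder s : (size s <= N)%N -> P (cylinder s) = (path_prob s)%:E.
Proof.
move=> sN; have [indep law] := eps_iid.
pose K := [fset k in iota 1 (size s)]%fset.
have inK k : (k \in K) = (1 <= k <= size s)%N.
  by rewrite in_fset /= mem_iota add1n ltnS.
pose B k : set R := [set sign_of (nth true s k.-1)].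
have -> : cylinder s = \bigcap_(k in [set` K]) eps k @^-1` B k.
  apply/seteqP; split=> w /= H.
    move=> k /=; rewrite inK => /andP[k0 ks]; rewrite /B /=.
    by rewrite -(prednK k0) H // prednK.
  by move=> k ks; apply: (H k.+1) => /=; rewrite inK.
rewrite indep.
- rewrite (perm_big (iota 1 (size s)))/=; last first.
    apply: uniq_perm; rewrite ?fset_uniq ?iota_uniq// => k.
    by rewrite inK mem_iota add1n ltnS.
  rewrite -(addn0 1%N) iotaDl big_map /path_prob (big_nth true) -prodEFin.
  rewrite /index_iota subn0; apply: eq_big_seq => k; rewrite mem_iota /= => ks.
  have [hu hd] : P [set w | eps k.+1 w = 1] = p%:E /\
      P [set w | eps k.+1 w = -1] = q%:E.
    by apply: law; lia.
  by rewrite /B /= /sign_of /sign_prob; case: (nth true s k).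
- by move=> k /=; rewrite inK => /andP[k1 ks]; rewrite k1 (leq_trans ks).
- by move=> k _; exact: measurable_set1.
Qed.

Lemma path_prob_gt0 s : 0 < path_prob s.
Proof. by apply: prodr_gt0 => -[]. Qed.

(** Positive probability excludes emptiness; this supplies representatives for the nodes of the
    tree. *)
Lemma cylinder_neq0 s : (size s <= N)%N -> exists w, cylinder s w.
Proof.
move=> sN; apply/set0P/eqP => c0.
have := prob_cylinder sN; rewrite c0 measure0 => -[/esym/eqP].
by rewrite gt_eqF// path_prob_gt0.
Qed.

Lemma path_prob_rcons s b : path_prob (rcons s b) = path_prob s * sign_prob b.
Proof. by rewrite /path_prob -cats1 big_cat big_seq1. Qed.

Lemma cylinder_disjoint s :
  [disjoint cylinder (rcons s true) & cylinder (rcons s false)].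
Proof.
apply/disj_setPRL; rewrite !cylinder_rcons => w /= [_ e1] [_].
by rewrite e1 /sign_of => ?; lra.
Qed.

(** Since [p + q = 1], the two extensions have together the probability of the cylinder. The
    outcomes with any other next sign form a null set, dropped from the integral. *)
Lemma integral_cylinder_rcons (X : T -> R) s : (size s < N)%N ->
  measurable_fun setT X -> (forall w, 0 <= X w) ->
  (\int[P]_(w in cylinder s) (X w)%:E =
   \int[P]_(w in cylinder (rcons s true)) (X w)%:E +
   \int[P]_(w in cylinder (rcons s false)) (X w)%:E)%E.
Proof.
move=> sN mX X0; pose U := cylinder (rcons s true) `|` cylinder (rcons s false).
have mU : measurable U by apply: measurableU; exact: measurable_cylinder.
have mXD D : measurable_fun D (EFin \o X).
  by apply/measurable_EFinP; apply: measurable_funS mX.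
have Us : U `<=` cylinder s.
  by move=> w; rewrite /U !cylinder_rcons => -[] [].
have PU : P U = P (cylinder s).
  transitivity (P (cylinder (rcons s true)) + P (cylinder (rcons s false)))%E.
    apply: measureU; [exact: measurable_cylinder|exact: measurable_cylinder|].
    by apply/eqP; have := cylinder_disjoint s; rewrite disj_set2E.
  rewrite !prob_cylinder ?size_rcons ?(ltnW sN)// !path_prob_rcons -EFinD -mulrDr.
  by rewrite /= pq1 mulr1.
rewrite (@ge0_negligible_integral _ _ _ _ (cylinder s) (cylinder s `\` U)).
- rewrite setDD setIidr//.
  rewrite ge0_integral_setU//; try exact: measurable_cylinder.
  + by move=> w _; rewrite lee_fin.
  + exact: cylinder_disjoint.
- by apply: measurableD => //; exact: measurable_cylinder.
- exact: measurable_cylinder.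
- exact: mXD.
- by move=> w _; rewrite lee_fin.
- transitivity (P (cylinder s) - P (cylinder s `&` U))%E.
    apply: measureD => //; first exact: measurable_cylinder.
    by rewrite (le_lt_trans (probability_le1 _ _))// ?ltry//; exact: measurable_cylinder.
  by rewrite setIidr// PU prob_cylinder ?subee// ltnW.
Qed.

(** The conditional mean of [f] given the sign path [s], with [n] signs to come. *)
Fixpoint tree_mean (f : bitseq -> R) n s : R :=
  if n is n'.+1
  then p * tree_mean f n' (rcons s true) + q * tree_mean f n' (rcons s false)
  else f s.

Lemma integral_cylinder (X : T -> R) f n s : (size s + n)%N = N ->
  measurable_fun setT X -> (forall w, 0 <= X w) ->
  (forall s w, size s = N -> cylinder s w -> X w = f s) ->
  (\int[P]_(w in cylinder s) (X w)%:E = (path_prob s * tree_mean f n s)%:E)%E.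
Proof.
move=> + mX X0 Xf; elim: n s => [|n IH] s sN.
  rewrite (eq_integral (cst (f s)%:E)) => [|w]; last first.
    by rewrite inE => ws /=; rewrite (Xf s)// -sN addn0.
  transitivity ((f s)%:E * P (cylinder s))%E.
    by apply: integral_cst; exact: measurable_cylinder.
  by rewrite prob_cylinder -?EFinM 1?mulrC//; lia.
rewrite integral_cylinder_rcons//; last by lia.
rewrite !IH ?size_rcons; [|lia..].
by rewrite -EFinD !path_prob_rcons /= mulrDr !mulrA.
Qed.

Lemma expectation_tree (X : T -> R) f :
  measurable_fun setT X -> (forall w, 0 <= X w) ->
  (forall s w, size s = N -> cylinder s w -> X w = f s) ->
  'E_P[X]%E = (tree_mean f N [::])%:E.
Proof.
move=> mX X0 Xf; rewrite unlock.
have := @integral_cylinder X f N [::] (add0n N) mX X0 Xf.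
by rewrite cylinder_nil /path_prob big_nil mul1r.
Qed.

Variables (s0 lambda : R).
Hypotheses (s0_gt0 : 0 < s0) (lambda_gt1 : 1 < lambda).
Let lambda_gt0 : 0 < lambda. Proof. exact: lt_trans lambda_gt1. Qed.
Let S := price s0 lambda (fun k => eps k : T -> R).

Lemma price_gt0 nu w : 0 < S nu w.
Proof. by rewrite mulr_gt0// powR_gt0. Qed.

Lemma measurable_price nu : measurable_fun setT (S nu).
Proof.
apply: measurable_funM; first exact: measurable_cst.
apply: (measurableT_comp (measurable_powRr lambda)).
by apply: measurable_sum => k; exact: measurable_funPT.
Qed.

Lemma agree_cylinder s w w' : cylinder s w -> cylinder s w' ->
  agree S (size s) w w'.
Proof.
move=> ws ws' j js; congr (_ * _ `^ _); apply: eq_big_nat => k /andP[k0 kj].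
have ks : (k.-1 < size s)%N by rewrite prednK// (leq_trans _ js).
by rewrite -(prednK k0) ws// ws'.
Qed.

Lemma price_rcons s b w w' : cylinder s w -> cylinder (rcons s b) w' ->
  S (size s).+1 w' = (if b then lambda else lambda^-1) * S (size s) w.
Proof.
move=> ws; rewrite cylinder_rcons => -[ws' /= eb].
rewrite (agree_cylinder ws ws' (leqnn _)) /S /price big_nat_recr//= eb.
rewrite powRD ?(gt_eqF lambda_gt0) ?implybT// mulrA mulrC; congr (_ * _).
by case: b {eb}; rewrite /sign_of ?powRr1 ?powR_inv1// ltW.
Qed.

End Cylinders.

(** * Comparing the expected reward with wealth by backward induction on the tree *)

Section Verification.
Context {d : measure_display} {T : measurableType d} {R : realType}.
Variables (P : probability T R) (r lambda s0 : R) (N m : nat).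
Variables (eps : nat -> {RV P >-> R}).
Hypotheses (lambda_gt1 : 1 < lambda) (lambda_r : lambda^-1 < 1 + r < lambda).
Hypothesis s0_gt0 : 0 < s0.
Local Notation p := (up_prob r lambda).
Local Notation q := (down_prob r lambda).
Hypothesis eps_iid : iid_signs N p q eps.
Set Implicit Arguments.
Unset Strict Implicit.
Let S := price s0 lambda (fun k => eps k : T -> R).
Let F := natural_filtration S.
Variable sigma : nat -> T -> date N.
Hypothesis sigma_adm : admissible F m sigma.
Local Notation W := (wealth r S m sigma lambda).

Let p_gt0 : 0 < p. Proof. exact: up_prob_gt0. Qed.
Let q_gt0 : 0 < q. Proof. exact: down_prob_gt0. Qed.
Let pq1 : p + q = 1. Proof. by rewrite /down_prob addrC subrK. Qed.
Let S_gt0 nu w : 0 < S nu w. Proof. exact: price_gt0. Qed.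

(** The reward is constant on cylinders of length [N], so any representative serves; [point] is the
    default on an empty cylinder. *)
Definition leaf_reward (s : bitseq) : R :=
  reward r S m sigma (xget point (cylinder eps s)).

Lemma reward_ge0 w : 0 <= reward r S m sigma w.
Proof.
apply: sumr_ge0 => i _; case: (sigma i w) => // k.
rewrite mulr_ge0// ?exprn_ge0 ?le_max ?lexx ?orbT//.
exact: ltW (discount_gt0 lambda_gt1 lambda_r).
Qed.

Lemma leaf_rewardE s w : size s = N -> cylinder eps s w ->
  reward r S m sigma w = leaf_reward s.
Proof.
move=> sN ws; have ws' : cylinder eps s (xget point (cylinder eps s)).
  exact: (xgetPex _ (ex_intro _ w ws)).
rewrite /leaf_reward -!past_end; apply: eq_past; apply: on_path_agree sigma_adm _ _ => //.
by rewrite -sN; exact: agree_cylinder.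
Qed.

Lemma expectation_reward :
  'E_P[reward r S m sigma]%E = (tree_mean p q leaf_reward N [::])%:E.
Proof.
apply: (expectation_tree p_gt0 q_gt0 pq1 eps_iid).
- apply: measurable_reward sigma_adm => j; exact: measurable_price.
- exact: reward_ge0.
- exact: leaf_rewardE.
Qed.

Let cylinder_on_path s b w w' : (size s < N)%N ->
  cylinder eps s w -> cylinder eps (rcons s b) w' ->
  on_path S m sigma (size s) w w'.
Proof.
move=> sN ws; rewrite cylinder_rcons => -[ws' _].
by apply: on_path_agree sigma_adm _ _; [exact: ltnW|exact: agree_cylinder].
Qed.

Let wealth_tree s w w1 w0 : (size s < N)%N -> cylinder eps s w ->
  cylinder eps (rcons s true) w1 -> cylinder eps (rcons s false) w0 ->
  p * W (size s).+1 w1 + q * W (size s).+1 w0 =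
  past r S m sigma (size s).+1 w + discount r ^+ size s * S (size s) w *
    hold_value r lambda N (remaining m sigma (size s).+1 w) (size s)
      (Defs.ratio S (size s) w).
Proof.
move=> sN ws ws1 ws0.
apply: (wealth_step r S_gt0 lambda_gt1 sN (cylinder_on_path sN ws ws1)
  (cylinder_on_path sN ws ws0)).
  exact: price_rcons ws ws1.
exact: price_rcons ws ws0.
Qed.

Let leaf_wealth s w : size s = N -> cylinder eps s w -> leaf_reward s =
  past r S m sigma N.+1 w + discount r ^+ N * S N w *
    hold_value r lambda N (remaining m sigma N.+1 w) N (Defs.ratio S N w).
Proof.
move=> sN ws; rewrite -(leaf_rewardE sN ws) -past_end /hold_value ltnn.
by rewrite mulr0 addr0.
Qed.

(** Induction on the number of signs to come, using arbitrary outcomes [w1] and [w0] of the two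
    successor cylinders: [wealth_step] gives their mean and [le_wealth] bounds it. *)
Lemma tree_mean_le n s w : (size s + n)%N = N -> cylinder eps s w ->
  tree_mean p q leaf_reward n s <= W (size s) w.
Proof.
have [_ nest] := sigma_adm.
elim: n s w => [|n IH] s w; first rewrite addn0 => sN ws.
  by rewrite /= (leaf_wealth sN ws) sN; exact: le_wealth.
move=> sn ws; have sN : (size s < N)%N by lia.
have [w1 ws1] : exists w1, cylinder eps (rcons s true) w1.
  by apply: (cylinder_neq0 p_gt0 q_gt0 eps_iid); rewrite size_rcons.
have [w0 ws0] : exists w0, cylinder eps (rcons s false) w0.
  by apply: (cylinder_neq0 p_gt0 q_gt0 eps_iid); rewrite size_rcons.
apply: le_trans (le_wealth S_gt0 lambda_gt1 lambda_r (nest w) (ltnW sN)).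
rewrite -(wealth_tree sN ws ws1 ws0) /= -(size_rcons s true).
apply: lerD; (rewrite ler_pM2l; last by []).
  by apply: IH; rewrite ?size_rcons//; lia.
by rewrite size_rcons -(size_rcons s false); apply: IH; rewrite ?size_rcons//; lia.
Qed.

Lemma tree_mean_eq n s w :
  (forall nu w, (nu <= N)%N -> let k := remaining m sigma nu w in
    (remaining m sigma nu.+1 w < k)%N =
      (0 < k)%N && (bA r lambda N k nu <= (Defs.ratio S nu w)%:E)%E) ->
  (size s + n)%N = N -> cylinder eps s w ->
  tree_mean p q leaf_reward n s = W (size s) w.
Proof.
have [_ nest] := sigma_adm.
move=> rule; elim: n s w => [|n IH] s w; first rewrite addn0 => sN ws.
  rewrite /= (leaf_wealth sN ws) sN; apply: eq_wealth => //; exact: rule.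
move=> sn ws; have sN : (size s < N)%N by lia.
have [w1 ws1] : exists w1, cylinder eps (rcons s true) w1.
  by apply: (cylinder_neq0 p_gt0 q_gt0 eps_iid); rewrite size_rcons.
have [w0 ws0] : exists w0, cylinder eps (rcons s false) w0.
  by apply: (cylinder_neq0 p_gt0 q_gt0 eps_iid); rewrite size_rcons.
rewrite -(eq_wealth S_gt0 lambda_gt1 lambda_r (nest w) (ltnW sN) (rule _ w (ltnW sN))).
rewrite -(wealth_tree sN ws ws1 ws0) /= (IH _ w1) ?(IH _ w0) ?size_rcons//; lia.
Qed.

End Verification.


Theorem theorem6p5 (R : realType) (d : measure_display) (T : measurableType d)
    (P : probability T R) (r lambda s0 : R) (N : nat)
    (eps : nat -> {RV P >-> R})
    (r_ge0 : 0 <= r) (lambda_gt1 : 1 < lambda)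
    (lambda_r : lambda^-1 < 1 + r < lambda) (s0_gt0 : 0 < s0)
    (eps_iid : iid_signs N (up_prob r lambda) (down_prob r lambda) eps) :
  let S := price s0 lambda (fun k => eps k : T -> R) in
  let F := natural_filtration S in
  forall m : nat, (1 <= m)%N ->
  [/\ forall nu : nat, (nu <= N)%N ->
        [/\ (bA r lambda N m nu < +oo)%E,
            DA r lambda N m nu `&` `[1, +oo[ =
              [set x : R | (bA r lambda N m nu <= x%:E)%E] &
            (bA r lambda N m.+1 nu <= bA r lambda N m nu)%E],
      admissible F m (sigma_star r lambda S N m),
      'E_P[reward r S m (sigma_star r lambda S N m)]%E =
        ereal_sup [set 'E_P[reward r S m sigma]%E |
                    sigma in [set sigma : nat -> T -> date N | admissible F m sigma]] &
      bA r lambda N m N = 1%E].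

Proof.
move=> S F m m1.
have S_gt0 nu w : 0 < S nu w by exact: price_gt0.
have star_adm := admissible_sigma_star N r lambda m S_gt0.
split; last exact: bA_terminal.
- move=> nu nuN; split; [exact: bA_fin|exact: DA_ge1|exact: bA_anti].
- exact: star_adm.
(* At date 0 nothing has been collected and all [m] rights are left, so the initial wealth does not
   depend on the vector; it is the optimal value. *)
have start (sigma : nat -> T -> date N) w : wealth r S m sigma lambda 0 w =
    wealth r S m (sigma_star r lambda S N m) lambda 0 w.
  by rewrite /wealth !past0 !remaining0.
(* Any outcome could replace [point], as the cylinder of the empty path is the whole space. *)
have star_opt : 'E_P[reward r S m (sigma_star r lambda S N m)]%E =
    (wealth r S m (sigma_star r lambda S N m) lambda 0 point)%:E.
  rewrite (expectation_reward lambda_gt1 lambda_r eps_iid star_adm).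
  congr EFin; apply: (tree_mean_eq lambda_gt1 lambda_r s0_gt0 eps_iid star_adm) => //.
  by move=> nu w nuN; exact: sigma_star_rule.
apply/eqP; rewrite eq_le; apply/andP; split.
  by apply: ereal_sup_ubound; exists (sigma_star r lambda S N m).
apply: ge_ereal_sup => _ [sigma sigma_adm <-].
rewrite star_opt (expectation_reward lambda_gt1 lambda_r eps_iid sigma_adm).
rewrite lee_fin -(start sigma).
by apply: (tree_mean_le lambda_gt1 lambda_r s0_gt0 eps_iid sigma_adm).
Qed.
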